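(* Let $(X, \mu, T)$ be a probability measure-preserving dynamical system, where $X$ is a metric space and $\mu$ is a Borel probability measure on $X$ such that the associated centered Hardy-Littlewood maximal operator is of weak type $(1,1)$, i.e. there exists a constant $C \geq 1$ such that $$\mu \left( \left\{ x \in X : \sup_{r > 0} \mu(B(x, r))^{-1} \int_{B(x, r)} |f| \,\mathrm{d} \mu \geq \epsilon \right\} \right) \leq \frac{C}{\epsilon} \|f\|_1 \quad \text{for all } f \in L^1(\mu),\ \epsilon > 0.$$ Then for all $p > 1$ and all $f \in L^p(\mu)$, we have $$\lim_{r \searrow 0,\, k \to \infty} \mu(B(x, r))^{-1} \int_{B(x, r)} \frac{1}{k} \sum_{j = 0}^{k - 1} f \circ T^j \,\mathrm{d} \mu = \mathbb{E} \left[ f \mid \mathfrak{I} \right](x) \quad \text{for } \mu\text{-almost every } x \in X,$$ where $\mathfrak{I}$ is the $\sigma$-algebra of $T$-invariant measurable subsets of $X$.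
   Context: $T : X \to X$ is a (Borel) measurable map with $\mu(T^{-1}E)=\mu(E)$ for all measurable $E$; it is not assumed continuous or invertible. $B(x,r)$ denotes the (open) ball of radius $r$ centered at $x$. Averages over a set are only considered for sets of positive measure; accordingly it is understood that $\mu(B(x,r))>0$ for all $r>0$, for $\mu$-almost every $x$. The limit $\lim_{r\searrow 0,\,k\to\infty}$ is a joint limit: for almost every $x$, for every $\epsilon>0$ there are $\delta>0$ and $K\in\mathbb{N}$ such that the quantity is within $\epsilon$ of the limit whenever $0<r<\delta$ and $k\geq K$. *)

(* Defs.v *)
From HB Require Import structures.
From mathcomp Require Import all_boot all_order all_algebra.
From mathcomp Require Import all_classical all_reals all_analysis.

Set Implicit Arguments.
Unset Strict Implicit.
Unset Printing Implicit Defensive.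

Import Order.TTheory GRing.Theory Num.Theory.
Import numFieldNormedType.Exports.

Local Open Scope classical_set_scope.
Local Open Scope ring_scope.

(* The library's measurable types are pointed. Pointing the metric space only
   excludes the empty one, which carries no probability measure. *)
#[short(type="pointedMetricType")]
HB.structure Definition PointedMetric (R : numDomainType) :=
  {X of Pointed X & Metric R X}.

(* [X] with its Borel sigma-algebra; unlike a bare [g_sigma_algebraType], this
   alias keeps the metric. *)
Definition borel (R : realType) (X : pointedMetricType R) : Type :=
  g_sigma_algebraType (@open X).

HB.instance Definition _ (R : realType) (X : pointedMetricType R) :=
  Measurable.copy (borel X) (g_sigma_algebraType (@open X)).
HB.instance Definition _ (R : realType) (X : pointedMetricType R) :=
  PointedMetric.copy (borel X) X.

Section ergodic_averages.
Context d (X : measurableType d) (R : realType).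
Variable mu : {measure set X -> \bar R}.

Definition measure_preserving (T : X -> X) :=
  measurable_fun [set: X] T /\
  forall E, measurable E -> mu (T @^-1` E) = mu E.

Definition invariant_sets (T : X -> X) : set (set X) :=
  [set E | measurable E /\ T @^-1` E = E].

Definition birkhoff_average (T : X -> X) (f : X -> R) (k : nat) (x : X) : R :=
  k%:R^-1 * \sum_(0 <= j < k) f (iter j T x).

(* If [mu A = 0], the integral vanishes and so does the average. *)
Definition average (f : X -> R) (A : set X) : \bar R :=
  ((mu A)^-1 * \int[mu]_(y in A) (f y)%:E)%E.

(* [g] is a version of the conditional expectation of [f] with respect to the
   sub-sigma-algebra [G]. *)
Definition is_cond_expectation (G : set (set X)) (f g : X -> R) :=
  [/\ forall B : set R, measurable B -> G (g @^-1` B),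
      mu.-integrable [set: X] (EFin \o g) &
      forall A, G A ->
        (\int[mu]_(x in A) (g x)%:E = \int[mu]_(x in A) (f x)%:E)%E].

(* A chosen version; versions agree almost everywhere. The default value 0 is
   only taken when there is no version, which cannot happen when [mu] is finite,
   [G] is a sub-sigma-algebra and [f] is integrable. *)
Definition cond_expectation (G : set (set X)) (f : X -> R) : X -> R :=
  xget (cst 0) [set g | is_cond_expectation G f g].

End ergodic_averages.

Section hardy_littlewood.
Context {R : realType} {X : pointedMetricType R}.
Variable mu : {measure set (borel X) -> \bar R}.

Definition maximal (f : borel X -> R) (x : borel X) : \bar R :=
  ereal_sup
    [set average mu (fun y => `|f y|) (ball x r) | r in [set r : R | 0 < r]].

Definition weak_type11_maximal :=
  exists2 C : R, 1 <= C &
    forall (f : borel X -> R) (e : R), f \in Lfun mu 1%E -> 0 < e ->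
      (mu [set x | e%:E <= maximal f x] <= (C / e)%:E * 'N[mu]_1[EFin \o f])%E.

End hardy_littlewood.

(* Main.v *)
Require Import Defs.
From HB Require Import structures.
From mathcomp Require Import all_boot all_order all_algebra.
From mathcomp Require Import all_classical all_reals all_analysis.
From mathcomp Require Import measurable_realfun ring lra.

Set Implicit Arguments.
Unset Strict Implicit.
Unset Printing Implicit Defensive.

Import Order.TTheory GRing.Theory Num.Theory.
Import numFieldNormedType.Exports.

Local Open Scope classical_set_scope.
Local Open Scope ring_scope.

(** Write A_k f for the Birkhoff averages, g for the conditional expectation of
    f given the invariant sets, and avg_r for the average over B(x, r). Then
    [avg_r (A_k f) - g x = avg_r (A_k f - g) + (avg_r g - g x)],
    and the two terms are controlled separately.

    The second term tends to 0 for almost every x by the Lebesgue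
    differentiation theorem ([lebesgue_differentiation_metric]). In a metric
    space with a weak type (1,1) maximal operator it holds for every integrable
    function: the set of functions that satisfy it is a closed linear subspace
    of L^1, and it contains the indicators of open sets.

    The first term has to be small uniformly in r, once k is large. Put
    [h_K = sup_(k >= K) |A_k f - g|], so that [|avg_r (A_k f - g)|] is at most
    the maximal function of h_K as soon as [k >= K], whatever r is. By the weak
    type inequality these maximal functions come arbitrarily close to 0 at
    almost every point ([averages_small]) provided that h_K tends to 0 in L^1.
    That is [birkhoff_tail_envelope]: h_K tends to 0 almost everywhere by the
    pointwise ergodic theorem, and it is dominated by [sup_k |A_k f| + |g|].
    Here p > 1 matters: the ergodic maximal function of f in L^p is integrable
    ([birkhoff_average_dominated]), which fails in general for f in L^1.

    Both ergodic facts, the pointwise theorem and the integrability of the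
    maximal function, follow from the maximal ergodic inequality
    [maximal_ergodic], proved by Garsia's argument. *)

(** * Auxiliary estimates *)

Lemma lt_archi_bound {R : realType} (x : R) : x < (Num.bound `|x|)%:R.
Proof. exact: le_lt_trans (ler_norm x) (archi_boundP (normr_ge0 x)). Qed.

Lemma exists_invS_le {R : realType} (e : R) : 0 < e ->
  exists n, n.+1%:R^-1 <= e.
Proof.
move=> e0; exists (Num.bound e^-1); rewrite invf_ple ?posrE//.
by rewrite (le_trans (ltW (archi_boundP _))) ?invr_ge0 ?ler_nat// ltW.
Qed.

Lemma measurable_lt_fun d (X : measurableType d) (R : realType) (f g : X -> R) :
  measurable_fun [set: X] f -> measurable_fun [set: X] g ->
  measurable [set x | f x < g x].
Proof.
move=> mf mg; rewrite (_ : [set x | _] = (g \- f) @^-1` `]0, +oo[).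
  by rewrite -[X in measurable X]setTI; exact: measurable_funB.
by apply/seteqP; split => x /=; rewrite in_itv/= andbT subr_gt0.
Qed.

(** Dividing by l^(p-1) gives [a <= l + l^(1-p) a^p]: up to the level l, a
    function is bounded, and above that level its p-th power controls it. This
    turns a weak type (1,1) bound for the p-th power into a tail bound of order
    l^(-p), summable against dyadic weights. *)
Lemma powR_truncate {R : realType} (a l p : R) : 1 < p -> 0 <= a -> 0 <= l ->
  a * l `^ (p - 1) <= l `^ p + a `^ p.
Proof.
move=> p1 a0 l0; have p0 : 0 < p by exact: lt_trans p1.
have [al|/ltW la] := leP a l.
  rewrite -(mulr_powRB1 l0 p0); apply: le_trans (ler_wpM2r (powR_ge0 _ _) al) _.
  by rewrite lerDl powR_ge0.
rewrite -(mulr_powRB1 a0 p0); apply: le_trans (_ : a * a `^ (p - 1) <= _).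
  apply: ler_wpM2l => //.
  by apply: ge0_ler_powR; rewrite ?nnegrE// subr_ge0 ltW.
by rewrite lerDr powR_ge0.
Qed.

Lemma geometric_nneseries_lty {R : realType} (a q : R) :
  0 <= a -> 0 < q < 1 -> (\sum_(n <oo) (a * q ^+ n)%:E < +oo)%E.
Proof.
move=> a0 /andP[q0 q1].
apply: (@le_lt_trans _ _ (a / (1 - q))%:E); last exact: ltry.
apply: lime_le.
  apply: is_cvg_nneseries => n _ _.
  by rewrite lee_fin mulr_ge0// exprn_ge0// ltW.
apply: nearW => n; rewrite sumEFin lee_fin.
have := geometric_le_lim n a0 q0; rewrite gtr0_norm// => /(_ q1).
by rewrite /series.
Qed.

(** * The maximal ergodic inequality *)

Definition birkhoff_sum {X : Type} {R : realType} (T : X -> X) (f : X -> R)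
    (n : nat) (x : X) : R :=
  \sum_(0 <= j < n) f (iter j T x).

Section birkhoff_sum.
Context {X : Type} {R : realType} (T : X -> X).
Implicit Types f g : X -> R.

Lemma birkhoff_sum0 f x : birkhoff_sum T f 0 x = 0.
Proof. by rewrite /birkhoff_sum big_nil. Qed.

Lemma birkhoff_sumS f n x :
  birkhoff_sum T f n.+1 x = f x + birkhoff_sum T f n (T x).
Proof.
rewrite /birkhoff_sum big_nat_recl//=; congr (_ + _).
by apply: eq_bigr => j _; rewrite -iterS iterSr.
Qed.

Lemma birkhoff_sumB_cst f (c : R) n x :
  birkhoff_sum T (fun y => f y - c) n x = birkhoff_sum T f n x - c *+ n.
Proof. by rewrite /birkhoff_sum sumrB sumr_const_nat subn0. Qed.

(** This is the maximum of 0 and of the Birkhoff sums of orders 1 to n. The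
    recursive form yields [M_(n+1) = f + M_n o T] wherever M_(n+1) is positive,
    which is what Garsia's argument uses. *)
Fixpoint birkhoff_max f (n : nat) (x : X) : R :=
  if n is m.+1 then Num.max 0 (f x + birkhoff_max f m (T x)) else 0.

Lemma birkhoff_max_ge0 f n x : 0 <= birkhoff_max f n x.
Proof. by case: n => [|n] //=; rewrite le_max lexx. Qed.

Lemma birkhoff_max_nd f n x : birkhoff_max f n x <= birkhoff_max f n.+1 x.
Proof.
elim: n x => [|n ih] x; first exact: birkhoff_max_ge0.
by rewrite [leLHS]/= [leRHS]/= ge_max !le_max lexx/= lerD2l ih orbT.
Qed.

Lemma birkhoff_sum_le_max f n x : birkhoff_sum T f n x <= birkhoff_max f n x.
Proof.
elim: n x => [|n ih] x; first by rewrite birkhoff_sum0.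
by rewrite birkhoff_sumS/= le_max lerD2l ih orbT.
Qed.

Lemma birkhoff_max_gt0 f n x : 0 < birkhoff_max f n x ->
  exists k, birkhoff_max f n x = birkhoff_sum T f k x.
Proof.
elim: n x => [|n ih] x /=; first by rewrite ltxx.
rewrite lt_max ltxx/= => gt0; rewrite max_r ?ltW//.
have := birkhoff_max_ge0 f n (T x).
rewrite le_eqVlt => /orP[/eqP <-|/ih[k ->]].
  by exists 1%N; rewrite birkhoff_sumS birkhoff_sum0.
by exists k.+1; rewrite birkhoff_sumS.
Qed.

End birkhoff_sum.

Section ergodic.
Context d (X : measurableType d) (R : realType) (mu : probability X R).
Variable T : X -> X.
Hypothesis T_preserving : measure_preserving mu T.
Implicit Types f h : X -> R.

Let mT : measurable_fun [set: X] T. Proof. by case: T_preserving. Qed.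

Let integral_mu_pushforward (f : X -> \bar R) :
  (\int[pushforward mu T]_x f x = \int[mu]_x f x)%E.
Proof. by apply: eq_measure_integral => A mA _; exact: T_preserving.2. Qed.

Lemma ge0_integral_preserving (f : X -> \bar R) :
  measurable_fun [set: X] f -> (forall x, 0 <= f x)%E ->
  (\int[mu]_x f (T x) = \int[mu]_x f x)%E.
Proof.
by move=> mf f0; rewrite -[RHS]integral_mu_pushforward ge0_integral_pushforward.
Qed.

Lemma integrable_preserving (f : X -> \bar R) :
  mu.-integrable [set: X] f -> mu.-integrable [set: X] (f \o T).
Proof.
move=> /integrableP[mf fi]; apply/integrableP; split.
  exact: measurableT_comp.
rewrite (ge0_integral_preserving (f := fun x => `|f x|%E))//.
exact: measurableT_comp.
Qed.

Lemma integral_preserving (f : X -> \bar R) : mu.-integrable [set: X] f ->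
  (\int[mu]_x f (T x) = \int[mu]_x f x)%E.
Proof.
move=> fi; rewrite -[RHS]integral_mu_pushforward integral_pushforward//.
- exact: measurable_int fi.
- exact: integrable_preserving.
Qed.

Lemma integrable_birkhoff_sum f n : mu.-integrable [set: X] (EFin \o f) ->
  mu.-integrable [set: X] (EFin \o birkhoff_sum T f n).
Proof.
move=> fi; elim: n => [|n ih].
  rewrite (_ : _ \o _ = cst 0%E); first exact: integrable0.
  by apply/funext => x /=; rewrite birkhoff_sum0.
rewrite (_ : _ \o _ = (EFin \o f) \+ (EFin \o birkhoff_sum T f n \o T))%E.
  by apply: integrableD => //; exact: integrable_preserving.
by apply/funext => x /=; rewrite birkhoff_sumS.
Qed.

Lemma integrable_birkhoff_max f n : mu.-integrable [set: X] (EFin \o f) ->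
  mu.-integrable [set: X] (EFin \o birkhoff_max T f n).
Proof.
move=> fi; elim: n => [|n ih]; first exact: (integrable0 mu).
set s := ((EFin \o f) \+ (EFin \o birkhoff_max T f n \o T))%E.
have si : mu.-integrable [set: X] s.
  by apply: integrableD => //; exact: integrable_preserving.
rewrite (_ : _ \o _ = s^\+)%E; first exact: integrable_funepos.
by apply/funext => x /=; rewrite funeposE /s/= -EFinD -EFin_max maxC.
Qed.

(** Garsia's argument: on [E = {M_n > 0}] one has [M_n <= f + M_n o T], so that
    the integral of f over E is at least that of [M_n - M_n o T]. Since M_n
    vanishes outside E and [M_n o T] is nonnegative, the latter is at least
    the integral of [M_n - M_n o T] over the whole space, which is 0 by
    invariance of the measure. *)
Lemma birkhoff_max_integral_ge0 f n : mu.-integrable [set: X] (EFin \o f) ->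
  0 <= \int[mu]_(x in [set x | 0 < birkhoff_max T f n x]) f x.
Proof.
move=> fi; set M := birkhoff_max T f n; set E := [set x | _].
have Mi : mu.-integrable [set: X] (EFin \o M) by exact: integrable_birkhoff_max.
have MTi : mu.-integrable [set: X] (EFin \o (M \o T)).
  exact: (@integrable_preserving (EFin \o M)).
have mM : measurable_fun [set: X] M.
  by apply/measurable_EFinP; exact: measurable_int Mi.
have mE : measurable E by exact: measurable_lt_fun.
have iE h : mu.-integrable [set: X] (EFin \o h) -> mu.-integrable E (EFin \o h).
  by move=> hi; apply: integrableS hi.
apply: (@le_trans _ _ (\int[mu]_(x in E) (M x - M (T x)))); last first.
  apply: le_Rintegral => //; last 1 first.
  - move=> x; rewrite /E/= => Mx.
    have : M x <= birkhoff_max T f n.+1 x by exact: birkhoff_max_nd.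
    rewrite /= le_max leNgt Mx/= lerBlDr; exact.
  - rewrite (_ : _ \o _ = (EFin \o M) \- (EFin \o (M \o T)))%E.
      by apply: integrableB => //; [exact: iE|exact: (iE (M \o T))].
    by apply/funext => x /=; rewrite EFinB.
  - exact: iE.
rewrite RintegralB//; [|exact: iE|exact: (iE (M \o T))].
rewrite subr_ge0 -[leRHS](_ : \int[mu]_x M x = _); last first.
  rewrite [RHS]Rintegral_mkcond; apply: eq_Rintegral => x _ /=.
  rewrite patchE; case: ifPn => // /negP; rewrite inE /E/= => /negP.
  by rewrite -leNgt => Mx; apply/eqP; rewrite eq_le Mx birkhoff_max_ge0.
rewrite [leRHS](_ : _ = \int[mu]_x M (T x)); last first.
  by rewrite /Rintegral (@integral_preserving (EFin \o M)).
rewrite Rintegral_mkcond; apply: le_Rintegral => //.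
- rewrite (_ : _ \o _ = (EFin \o (M \o T)) \_ E)%E.
    by rewrite -integrable_mkcond//; exact: iE.
  by rewrite restrict_EFin.
- by move=> x _; rewrite patchE; case: ifPn => //= _; exact: birkhoff_max_ge0.
Qed.

Lemma measurable_birkhoff_sum f n : measurable_fun [set: X] f ->
  measurable_fun [set: X] (birkhoff_sum T f n).
Proof.
move=> mf; elim: n => [|n ih].
  rewrite (_ : birkhoff_sum _ _ _ = cst 0)//.
  by apply/funext => x; rewrite birkhoff_sum0.
rewrite (_ : birkhoff_sum _ _ _ = f \+ (birkhoff_sum T f n \o T)).
  by apply: measurable_funD => //; exact: measurableT_comp.
by apply/funext => x; rewrite birkhoff_sumS.
Qed.

Lemma measurable_exists_lt_birkhoff_sum f (l : R) : measurable_fun [set: X] f ->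
  measurable [set x | exists n, l *+ n < birkhoff_sum T f n x].
Proof.
move=> mf; rewrite (_ : [set x | _] =
    \bigcup_n [set x | l *+ n < birkhoff_sum T f n x]).
  apply: bigcupT_measurable => n; apply: measurable_lt_fun => //.
  exact: measurable_birkhoff_sum.
by apply/seteqP; split => [x [n ?]|x [n _ ?]]; exists n.
Qed.

(** The sets where birkhoff_max is positive increase to the set below, so the
    inequality passes to the limit by dominated convergence. *)
Lemma maximal_ergodic f : mu.-integrable [set: X] (EFin \o f) ->
  0 <= \int[mu]_(x in [set x | exists n, 0 < birkhoff_sum T f n x]) f x.
Proof.
move=> fi; have mf : measurable_fun [set: X] f.
  by apply/measurable_EFinP; exact: measurable_int fi.
set E := [set x | _].
have mE : measurable E.
  have := measurable_exists_lt_birkhoff_sum 0 mf.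
  by under eq_set do under eq_exists do rewrite mul0rn.
pose F n := [set x | 0 < birkhoff_max T f n x].
have mF n : measurable (F n).
  apply: measurable_lt_fun => //; apply/measurable_EFinP.
  exact: (measurable_int mu (integrable_birkhoff_max n fi)).
pose f_ n := (EFin \o f) \_ (F n).
have [|||||_ _ f_cvg] := @dominated_convergence _ _ _ mu _ measurableT
    f_ ((EFin \o f) \_ E) (abse \o EFin \o f).
- move=> n; apply/(measurable_restrictT _ _).1 => //.
  by apply: measurable_funS (measurable_int _ fi).
- apply/(measurable_restrictT _ _).1 => //.
  by apply: measurable_funS (measurable_int _ fi).
- apply: aeW => x _; apply: cvg_near_cst.
  have [Ex|Ex] := pselect (E x); last first.
    apply: nearW => n; rewrite /f_ !patchE !memNset// => Fnx; apply: Ex.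
    by have [k Mk] := birkhoff_max_gt0 Fnx; exists k; rewrite -Mk.
  have [k Sk] := Ex.
  exists k => // n /= kn; rewrite /f_ !patchE !mem_set// /F/=.
  apply: lt_le_trans Sk _; apply: le_trans (birkhoff_sum_le_max _ _ _ _) _.
  by have /nondecreasing_seqP := birkhoff_max_nd T f ^~ x; exact.
- exact: integrable_abse.
- apply: aeW => x n _; rewrite /f_ patchE; case: ifPn => // _.
  by rewrite (_ : point = 0%E)// abse0; exact: abse_ge0.
rewrite -lee_fin /Rintegral fineK; last first.
  by apply: integrable_fin_num => //; apply: integrableS fi.
rewrite integral_mkcond -(cvg_lim _ f_cvg)//; apply: lime_ge.
  by apply/cvg_ex; eexists; exact: f_cvg.
apply: nearW => n /=; rewrite /f_ -integral_mkcond.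
have := birkhoff_max_integral_ge0 n fi.
rewrite -lee_fin /Rintegral fineK//.
apply: integrable_fin_num; first exact: mF.
by apply: integrableS fi => //; exact: mF.
Qed.

(** The maximal ergodic inequality applied to [f - l]. *)
Lemma weak_type11_birkhoff f (l : R) : mu.-integrable [set: X] (EFin \o f) ->
  (forall x, 0 <= f x) -> 0 < l ->
  l * fine (mu [set x | exists n, l *+ n < birkhoff_sum T f n x]) <=
  \int[mu]_x f x.
Proof.
move=> fi f0 l0; set E := [set x | _].
have mf : measurable_fun [set: X] f.
  by apply/measurable_EFinP; exact: measurable_int fi.
have mE : measurable E by exact: measurable_exists_lt_birkhoff_sum.
have li : mu.-integrable [set: X] (EFin \o cst l).
  exact: finite_measure_integrable_cst.
have := @maximal_ergodic (fun x => f x - l); set E' := [set x | _].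
have -> : E' = E.
  apply: eq_set => x; apply: eq_exists => n.
  by rewrite birkhoff_sumB_cst subr_gt0.
rewrite RintegralB//; [|exact: integrableS fi|exact: integrableS li].
rewrite Rintegral_cst// subr_ge0 => lE.
apply: le_trans (lE _) _; first exact: (integrableB measurableT fi li).
rewrite Rintegral_mkcond; apply: le_Rintegral => //.
- rewrite -restrict_EFin -integrable_mkcond//; exact: integrableS fi.
- by move=> x _; rewrite patchE; case: ifPn.
Qed.

(** * The pointwise ergodic theorem *)

(** The set A of points where the Birkhoff sums of [h = f - e] are unbounded
    above is exactly invariant, since the sums at [T x] and at x differ by
    [h x]. Hence the maximal ergodic inequality for the restriction of h to A
    has A as its maximal set, and says that the integral of h over A, that is
    [- e * mu A], is nonnegative. So A is a null set. *)
Lemma birkhoff_sum_ub f (e : R) : mu.-integrable [set: X] (EFin \o f) ->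
  (forall A, invariant_sets T A -> \int[mu]_(x in A) f x = 0) -> 0 < e ->
  {ae mu, forall x, exists N : nat, forall k,
    birkhoff_sum T f k x <= e *+ k + N%:R}.
Proof.
move=> fi f0 e0; pose h x := f x - e.
have mf : measurable_fun [set: X] f.
  by apply/measurable_EFinP; exact: measurable_int fi.
have mh : measurable_fun [set: X] h by exact: measurable_funB.
have ei : mu.-integrable [set: X] (EFin \o cst e).
  exact: finite_measure_integrable_cst.
have hi : mu.-integrable [set: X] (EFin \o h).
  exact: (integrableB measurableT fi ei).
pose A := [set x | forall N : nat, exists k, N%:R < birkhoff_sum T h k x].
have mA : measurable A.
  rewrite (_ : A = \bigcap_N \bigcup_k [set x | N%:R < birkhoff_sum T h k x]).
    apply: bigcapT_measurable => N; apply: bigcupT_measurable => k.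
    by apply: measurable_lt_fun => //; exact: measurable_birkhoff_sum.
  apply/seteqP; split => [x Ax N _|x Ax N]; first by have [k] := Ax N; exists k.
  by have [k _] := Ax N I; exists k.
have TA : T @^-1` A = A.
  apply/seteqP; split => [x ATx N|x Ax N].
    have [k ltS] := ATx (Num.bound `|N%:R - h x|); exists k.+1.
    rewrite birkhoff_sumS -ltrBlDl; apply: lt_trans ltS; exact: lt_archi_bound.
  have [k] := Ax (N + Num.bound `|h x|)%N; case: k => [|k].
    by rewrite birkhoff_sum0 ltNge ler0n.
  rewrite birkhoff_sumS natrD => ltS; exists k.
  rewrite -(ltrD2l (h x)); apply: lt_trans ltS.
  by rewrite addrC ltrD2l lt_archi_bound.
have invA : invariant_sets T A by [].
(* By invariance of A, an orbit stays in A or stays out of A, so that cutting h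
   off A either keeps the Birkhoff sums or makes all of them vanish. *)
pose hA := h \_ A.
have SA n x :
    birkhoff_sum T hA n x = if x \in A then birkhoff_sum T h n x else 0.
  elim: n x => [|n ih] x; first by rewrite !birkhoff_sum0 if_same.
  rewrite !birkhoff_sumS ih /hA patchE.
  have -> : (T x \in A) = (x \in A).
    by rewrite -[in RHS]TA; apply/idP/idP; rewrite !inE.
  by case: ifP => // _; rewrite addr0.
have hAi : mu.-integrable [set: X] (EFin \o hA).
  by rewrite /hA -restrict_EFin -integrable_mkcond//; exact: integrableS hi.
have := maximal_ergodic hAi; set E := [set x | _].
have -> : E = A.
  apply/seteqP; split => [x [n]|x Ax]; rewrite ?SA.
    by case: ifPn; rewrite ?ltxx// inE.
  by have [k Sk] := Ax 0; exists k; rewrite SA mem_set.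
rewrite (_ : \int[mu]_(x in A) hA x = \int[mu]_(x in A) h x); last first.
  by apply: eq_Rintegral => x xA; rewrite /hA patchE xA.
rewrite RintegralB//; [|exact: integrableS fi|exact: integrableS ei].
rewrite f0// Rintegral_cst// sub0r oppr_ge0 pmulr_rle0// => muA.
have A0 : mu A = 0%E.
  apply/eqP; rewrite eq_le measure_ge0 andbT -[mu A]fineK ?lee_fin//.
  exact: fin_num_measure.
exists A; split => // x /= xA N; apply: contrapT => /forallNP ub; apply: xA.
exists N => k; rewrite -lerBlDl -birkhoff_sumB_cst leNgt; apply/negP.
exact: ub.
Qed.

(** Bounds [S_k f <= e k + N], for every e and for f and its opposite, make the
    averages [S_k f / k] tend to 0. *)
Lemma birkhoff_ergodic_centered f : mu.-integrable [set: X] (EFin \o f) ->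
  (forall A, invariant_sets T A -> \int[mu]_(x in A) f x = 0) ->
  {ae mu, forall x, birkhoff_average T f k x @[k --> \oo] --> 0}.
Proof.
move=> fi f0.
have fNi : mu.-integrable [set: X] (EFin \o (\- f)).
  exact: (integrableN fi).
have fN0 A : invariant_sets T A -> \int[mu]_(x in A) (\- f) x = 0.
  move=> /[dup] -[mA _] /f0 fA; rewrite -[RHS]oppr0 -fA -mulN1r -RintegralZl//.
    by apply: eq_Rintegral => x _ /=; rewrite mulN1r.
  exact: integrableS fi.
have invn0 n : 0 < n.+1%:R^-1 :> R by rewrite invr_gt0.
have := ae_foralln (fun n => birkhoff_sum_ub fNi fN0 (invn0 n)).
have := ae_foralln (fun n => birkhoff_sum_ub fi f0 (invn0 n)).
apply: filterS2 => x ub lb; apply/cvgrPdist_le => e e0.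
have [n n_e] := exists_invS_le (divr_gt0 e0 (ltr0n R 2)).
have [N1 {}ub] := ub n; have [N2 {}lb] := lb n.
near=> k; have k0 : 0 < k%:R :> R.
  by rewrite ltr0n; near: k; exact: nbhs_infty_gt.
have [N1k N2k] : N1%:R <= e / 2 * k%:R /\ N2%:R <= e / 2 * k%:R.
  rewrite -!ler_pdivrMl ?divr_gt0//; split; near: k; exact: nbhs_infty_ger.
have n_ek : n.+1%:R^-1 *+ k <= e / 2 * k%:R.
  by rewrite -[leLHS]mulr_natr ler_pM2r.
rewrite sub0r normrN /birkhoff_average -/(birkhoff_sum T f k x).
rewrite normrM gtr0_norm ?invr_gt0// ler_pdivrMl// ler_norml.
have := lb k; have := ub k.
rewrite {2}/birkhoff_sum sumrN -/(birkhoff_sum T f k x) => + +.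
move: n_ek N1k N2k.
have -> : e / 2 * k%:R = k%:R * e / 2 by rewrite mulrC mulrA.
move: (_ *+ k) (k%:R * e) => a b ? ? ? ? ?; apply/andP; split; lra.
Unshelve. all: by end_near. Qed.

(** * Integrability of the ergodic maximal function *)

Lemma normr_birkhoff_sum f k x :
  `|birkhoff_sum T f k x| <= birkhoff_sum T (Num.norm \o f) k x.
Proof. exact: ler_norm_sum. Qed.

(** By [powR_truncate], if the average of [|f|] exceeds [2 l] then that of
    [|f|^p] exceeds [l^p]; the weak type (1,1) inequality for [|f|^p] gives the
    bound. *)
Lemma weak_type_birkhoff_powR f (p l : R) :
  1 < p -> f \in Lfun mu p%:E -> 0 < l ->
  l `^ p * fine (mu [set x | exists n,
      (2 * l) *+ n < birkhoff_sum T (Num.norm \o f) n x]) <=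
  \int[mu]_x (`|f x| `^ p).
Proof.
move=> p1 fp l0; set E := [set x | _].
have mf : measurable_fun [set: X] f by move: fp; rewrite inE => /andP[/[!inE]].
have mE : measurable E.
  by apply: measurable_exists_lt_birkhoff_sum; exact: measurableT_comp.
pose g x := `|f x| `^ p.
have gi : mu.-integrable [set: X] (EFin \o g).
  exact: Lfun_integrable (ltW p1) fp.
have mg : measurable_fun [set: X] g.
  by apply/measurable_EFinP; exact: measurable_int gi.
have lp0 : 0 < l `^ p by rewrite powR_gt0.
have lp10 : 0 < l `^ (p - 1) by rewrite powR_gt0.
apply: le_trans (weak_type11_birkhoff gi (fun x => powR_ge0 _ _) lp0).
apply: ler_wpM2l; first exact: ltW.
apply: fine_le; [exact: fin_num_measure| |].
  apply: fin_num_measure; exact: measurable_exists_lt_birkhoff_sum.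
apply: le_measure; rewrite ?inE//.
  exact: measurable_exists_lt_birkhoff_sum.
move=> x [n]; exists n; rewrite -/g.
have Sfg : birkhoff_sum T (Num.norm \o f) n x * l `^ (p - 1) <=
    l `^ p *+ n + birkhoff_sum T g n x.
  rewrite /birkhoff_sum mulr_suml -[X in _ <= _ *+ X + _]subn0.
  rewrite -sumr_const_nat -big_split/=.
  by apply: ler_sum => j _; apply: powR_truncate => //; exact: ltW.
have : (2 * l) *+ n * l `^ (p - 1) <
    birkhoff_sum T (Num.norm \o f) n x * l `^ (p - 1) by rewrite ltr_pM2r.
move=> /lt_le_trans/(_ Sfg).
rewrite mulrnAl -mulrA mulr_powRB1 ?(lt_trans _ p1)//; last exact: ltW.
by rewrite mulr_natl mulrnAC mulr2n ltrD2l.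
Qed.

(** The maximal function is cut at dyadic levels: it is at most
    [2 + sum_n 2^(n+2) 1_(E_n)], where E_n is the set on which it exceeds
    2^(n+1). The integral of the n-th term is at most a constant times
    2^(n(1-p)), the general term of a convergent series because p > 1. *)
Lemma birkhoff_average_dominated f (p : R) : 1 < p -> f \in Lfun mu p%:E ->
  exists2 G : X -> \bar R, mu.-integrable [set: X] G &
    forall k x, (`|birkhoff_average T f k x|%:E <= G x)%E.
Proof.
move=> p1 fp.
have mf : measurable_fun [set: X] f by move: fp; rewrite inE => /andP[/[!inE]].
pose E n := [set x | exists k,
  (2 * 2 ^+ n) *+ k < birkhoff_sum T (Num.norm \o f) k x].
have mE n : measurable (E n).
  by apply: measurable_exists_lt_birkhoff_sum; exact: measurableT_comp.
pose t n x : \bar R := (4 * 2 ^+ n * \1_(E n) x)%:E.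
have t0 n x : (0 <= t n x)%E.
  by rewrite lee_fin !mulr_ge0// exprn_ge0.
have mt n : measurable_fun [set: X] (t n).
  by apply/measurable_EFinP; exact: measurable_funM.
have st0 x : (0 <= \sum_(n <oo) t n x)%E by exact: nneseries_ge0.
pose G x : \bar R := (2%:E + \sum_(n <oo) t n x)%E.
have mst : measurable_fun [set: X] (fun x => \sum_(n <oo) t n x)%E.
  by apply: ge0_emeasurable_sum.
exists G.
  apply: integrableD => //; first exact: finite_measure_integrable_cst.
  apply/integrableP; split => //.
  under eq_integral do rewrite gee0_abs//.
  rewrite integral_nneseries//.
  pose I := \int[mu]_x (`|f x| `^ p).
  have I0 : 0 <= I by apply: Rintegral_ge0 => x _; exact: powR_ge0.
  pose q : R := 2 `^ (1 - p).
  have q01 : 0 < q < 1.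
    rewrite powR_gt0//= /q -opprB powRN invf_lt1 ?powR_gt0//.
    have : (1 : R) `^ (p - 1) < 2 `^ (p - 1).
      by rewrite gt0_ltr_powR ?nnegrE ?subr_gt0 ?ltr1n.
    by rewrite powR1.
  apply: le_lt_trans (geometric_nneseries_lty (mulr_ge0 (ler0n _ 4) I0) q01).
  apply: lee_nneseries => n _; first by move=> _; exact: integral_ge0.
  rewrite /t; under eq_integral do rewrite EFinM.
  rewrite integralZl//; last exact: integrable_indic.
  rewrite integral_indic// setIT -[X in (_ * X <= _)%E]fineK ?fin_num_measure//.
  rewrite -EFinM lee_fin.
  have := weak_type_birkhoff_powR p1 fp (exprn_gt0 n (ltr0n R 2)).
  rewrite -/(E n) -/I => wk.
  have -> : q ^+ n = 2 ^+ n / (2 ^+ n) `^ p.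
    rewrite -!powR_mulrn ?powR_ge0// /q -!powRrM -powRN.
    rewrite -powRD ?pnatr_eq0 ?implybT//.
    by congr (_ `^ _); ring.
  rewrite -2!mulrA ler_pM2l// mulrCA ler_pM2l ?exprn_gt0//.
  by rewrite ler_pdivlMr ?powR_gt0 ?exprn_gt0// mulrC.
move=> k x; set a := birkhoff_average T (Num.norm \o f) k x.
have aE : a = k%:R^-1 * birkhoff_sum T (Num.norm \o f) k x by [].
apply: (@le_trans _ _ a%:E).
  rewrite lee_fin aE normrM ger0_norm ?invr_ge0//.
  by rewrite ler_wpM2l ?invr_ge0//; exact: normr_birkhoff_sum.
have [a2|a2] := leP a 2.
  by rewrite /G -[leLHS]adde0 leeD// lee_fin.
have : exists n, a <= 2 * 2 ^+ n.+1.
  exists (Num.bound `|a|); apply: le_trans (ltW (lt_archi_bound a)) _.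
  rewrite -exprS -natrX ler_nat.
  apply: (leq_trans (ltnW (ltn_expl (Num.bound `|a|) (isT : (1 < 2)%N)))).
  by apply: leq_pexp2l => //; rewrite -addn2 leq_addr.
(* Minimality of n puts a in the dyadic interval between 2^(n+1) and 2^(n+2). *)
move=> /ex_minnP[n an nmin].
have an1 : 2 * 2 ^+ n < a.
  case: n an nmin => [|n] _ nmin; first by rewrite expr0 mulr1.
  by rewrite ltNge; apply/negP => /nmin; rewrite ltnn.
have k0 : (0 < k)%N.
  rewrite lt0n; apply: contraTneq a2 => k0.
  by rewrite aE k0 birkhoff_sum0 mulr0 -leNgt.
have Enx : E n x.
  by exists k; rewrite -[ltLHS]mulr_natl -ltr_pdivlMl ?ltr0n.
rewrite /G (@nneseriesD1 _ _ n)//.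
apply: (@le_trans _ _ (t n x)).
  rewrite /t indicE mem_set// mulr1 lee_fin; apply: le_trans an _.
  by rewrite exprS mulrA -natrM.
by rewrite addeCA leeDl// adde_ge0// ?lee_fin// nneseries_ge0.
Qed.
End ergodic.

(** * Conditional expectations and the ergodic theorem *)

Section conditional_expectation.
Context d (X : measurableType d) (R : realType) (mu : probability X R).
Variable G : set (set X).
Hypothesis sG : sigma_algebra [set: X] G.
Hypothesis G_measurable : G `<=` measurable.
Implicit Types f g : X -> R.

(** The same points with the coarser sigma-algebra G: the image of mu under the
    identity map to this space is the restriction of mu to G. *)
Let Y := g_sigma_algebraType G.
Let emb : X -> Y := idfun.

Let measurableY (A : set Y) : measurable A = G A.
Proof. by rewrite /measurable/= sigma_algebra_id. Qed.

Let memb : measurable_fun [set: X] emb.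
Proof. by move=> _ A; rewrite measurableY setTI => /G_measurable. Qed.

HB.instance Definition _ := isMeasurableFun.Build _ _ _ _ emb memb.

(** The conditional expectation is the Radon-Nikodym derivative, on the coarser
    space, of the charge with density f with respect to the restriction of
    mu. *)
Lemma is_cond_expectation_exists f : mu.-integrable [set: X] (EFin \o f) ->
  exists g, is_cond_expectation mu G f g.
Proof.
move=> fi.
have [nu nuE] : exists nu : {charge set Y -> \bar R},
    forall A, nu A = (\int[mu]_(x in A) (f x)%:E)%E.
  by unshelve eexists (pushforward (induced_charge fi) emb).
pose m := distribution mu emb.
have num : nu `<< m.
  apply/null_content_dominatesP => A; rewrite measurableY => GA A0.
  have mA := G_measurable GA; rewrite nuE null_set_integral//.
  by apply: measurable_funS (measurable_int _ fi).
pose h := Radon_Nikodym nu m.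
have hi : m.-integrable [set: Y] h by exact: Radon_Nikodym_integrable.
have hfin y : h y \is a fin_num by exact: Radon_Nikodym_fin_num.
have mh : measurable_fun [set: Y] h by exact: measurable_int hi.
have hX : EFin \o (fine \o h) = h \o emb.
  by apply/funext => x /=; rewrite fineK.
have hiX : mu.-integrable [set: X] (h \o emb).
  apply/integrableP; split; first exact: measurableT_comp.
  have /integrableP[_] := hi.
  by rewrite ge0_integral_pushforward//; exact: measurableT_comp.
exists (fine \o h); split.
- move=> B mB; rewrite -measurableY -[X in measurable X]setTI.
  by apply: measurableT_comp mB => //.
- by rewrite hX.
- move=> A GA; have mA : measurable (A : set Y) by rewrite measurableY.
  rewrite -nuE (Radon_Nikodym_integral num mA) integral_pushforward//.
    by apply: eq_integral => x _ /=; rewrite fineK.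
  by apply: integrableS hiX => //; exact: G_measurable.
Qed.
End conditional_expectation.

Section ergodic.
Context d (X : measurableType d) (R : realType) (mu : probability X R).
Variable T : X -> X.
Hypothesis T_preserving : measure_preserving mu T.
Implicit Types f g : X -> R.

Lemma sigma_algebra_invariant_sets : sigma_algebra [set: X] (invariant_sets T).
Proof.
split.
- by split; [exact: measurable0|rewrite preimage_set0].
- move=> A [mA TA]; split; first exact: measurableD.
  by rewrite setTD -preimage_setC TA.
- move=> A inv; split; first by apply: bigcupT_measurable => n; case: (inv n).
  by rewrite preimage_bigcup; apply: eq_bigcupr => n _; case: (inv n).
Qed.

Lemma cond_expectation_invariantP f : mu.-integrable [set: X] (EFin \o f) ->
  is_cond_expectation mu (invariant_sets T) f
    (cond_expectation mu (invariant_sets T) f).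
Proof.
move=> fi; apply: (@xgetPex _ _ [set g | is_cond_expectation _ _ _ g]).
apply: is_cond_expectation_exists fi; first exact: sigma_algebra_invariant_sets.
by move=> A [].
Qed.

(** The level set of g through x is invariant, hence contains the orbit of
    x. *)
Lemma invariant_measurable_iter g n x :
  (forall B : set R, measurable B -> invariant_sets T (g @^-1` B)) ->
  g (iter n T x) = g x.
Proof.
move=> gG; have gT y : g (T y) = g y.
  have [_ /seteqP[_ sub]] := gG _ (measurable_set1 (g y)).
  exact: (sub y erefl).
by elim: n => //= n ih; rewrite gT.
Qed.

Lemma integrable_birkhoff_average f n : mu.-integrable [set: X] (EFin \o f) ->
  mu.-integrable [set: X] (EFin \o birkhoff_average T f n).
Proof.
move=> fi; exact: (integrableZl measurableT n%:R^-1
  (integrable_birkhoff_sum T_preserving n fi)).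
Qed.

(** The difference [f - g] has integral 0 over every invariant set, and g is
    constant along orbits, so the averages of [f - g] are [A_k f - g]. *)
Lemma birkhoff_ergodic f g : mu.-integrable [set: X] (EFin \o f) ->
  is_cond_expectation mu (invariant_sets T) f g ->
  {ae mu, forall x, birkhoff_average T f k x - g x @[k --> \oo] --> 0}.
Proof.
move=> fi [gG gi fg].
have phii : mu.-integrable [set: X] (EFin \o (f \- g)).
  exact: (integrableB measurableT fi gi).
have phi0 A : invariant_sets T A -> \int[mu]_(x in A) (f x - g x) = 0.
  move=> invA; have mA : measurable A by case: invA.
  rewrite RintegralB//; [|exact: integrableS fi|exact: integrableS gi].
  by rewrite /Rintegral fg// subrr.
apply: filterS (birkhoff_ergodic_centered T_preserving phii phi0) => x.
apply: cvg_trans; apply: near_eq_cvg; near=> k.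
have k0 : k%:R != 0 :> R.
  by rewrite pnatr_eq0 -lt0n; near: k; exact: nbhs_infty_gt.
rewrite /birkhoff_average sumrB mulrBr; congr (_ - _).
under eq_bigr do rewrite (invariant_measurable_iter _ _ gG).
by rewrite sumr_const_nat subn0 -[X in _ * X]mulr_natl mulKf.
Unshelve. all: by end_near. Qed.

(** The envelope is [h K = sup_(k >= K) |A_k f - g|]. The supremum may be
    infinite on a null set; [h K] takes the value 0 there, which is why the
    last property holds almost everywhere only. *)
Lemma birkhoff_tail_envelope f g (p : R) : 1 < p -> f \in Lfun mu p%:E ->
  is_cond_expectation mu (invariant_sets T) f g ->
  exists h : nat -> X -> R,
    [/\ forall K, mu.-integrable [set: X] (EFin \o h K),
        \int[mu]_x `|h K x| @[K --> \oo] --> 0 &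
        forall K k, (K <= k)%N ->
          {ae mu, forall x, `|birkhoff_average T f k x - g x| <= h K x}].
Proof.
move=> p1 fp gE; have [gG gi fg] := gE.
have fi : mu.-integrable [set: X] (EFin \o f).
  apply/Lfun1_integrable; apply: Lfun_subset fp;
    by rewrite ?fin_num_measure// ?lee_fin ltW.
have [G Gi fG] := birkhoff_average_dominated T_preserving p1 fp.
pose u x k : \bar R := `|birkhoff_average T f k x - g x|%:E.
pose H K x := esups (u x) K.
have mu_ k : measurable_fun [set: X] (u ^~ k).
  apply/measurable_EFinP; apply: measurableT_comp => //; apply: measurable_funB.
    apply/measurable_EFinP.
    exact: measurable_int (integrable_birkhoff_average k fi).
  by apply/measurable_EFinP; exact: measurable_int gi.
have mH K : measurable_fun [set: X] (H K).
  apply: (@measurable_fun_esups _ _ _ setT (fun n x => u x n)) => n.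
  exact: mu_.
have u0 x k : (0 <= u x k)%E by rewrite lee_fin.
have uH x K k : (K <= k)%N -> (u x k <= H K x)%E.
  by move=> Kk; apply: ereal_sup_ubound; exists k.
have H0 K x : (0 <= H K x)%E by exact: le_trans (u0 x K) (uH x K K (leqnn K)).
pose E x := (G x + `|g x|%:E)%E.
have Ei : mu.-integrable [set: X] E.
  by apply: integrableD => //; exact: (integrable_norm gi).
have HE K x : (H K x <= E x)%E.
  apply: ge_ereal_sup => _ [k _ <-]; apply: le_trans (leeD2r _ (fG k x)).
  by rewrite -EFinD lee_fin ler_normB.
have [||||| _ H_cvg _] := @dominated_convergence _ _ _ mu _ measurableT
    H (cst 0%E) E.
- by [].
- by [].
- apply: filterS (birkhoff_ergodic fi gE) => x D0 _; apply: cvg_esups.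
  apply: cvg_EFin; first exact: nearW.
  by rewrite -[X in _ --> X](normr0 R); exact: cvg_norm.
- by [].
- by apply: aeW => x K _; rewrite gee0_abs.
pose h K x := fine (H K x).
have mh K : measurable_fun [set: X] (EFin \o h K).
  by apply/measurable_EFinP; exact: measurableT_comp.
have hH K x : (`|(h K x)%:E| <= `|H K x|)%E.
  by rewrite /h; case: (H K x) => [r| |]//=; rewrite normr0 leey.
have Hi K : mu.-integrable [set: X] (H K).
  apply: le_integrable Ei => // x _.
  by rewrite gee0_abs// (le_trans (HE K x))// lee_abs.
have hi K : mu.-integrable [set: X] (EFin \o h K).
  by apply: le_integrable (Hi K) => // x _; exact: hH.
exists h; split=> // [|K k Kk].
- apply: (@squeeze_cvgr _ _ _ _ (cst 0)
    (fun K => fine (\int[mu]_x `|H K x|)%E)).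
  + apply: nearW => K; rewrite Rintegral_ge0//=; apply: fine_le.
    * by apply: integrable_fin_num => //; exact: integrable_abse (hi K).
    * by apply: integrable_fin_num => //; exact: integrable_abse (Hi K).
    * apply: ge0_le_integral => //; last by move=> x _; exact: hH.
        exact: (measurable_int mu (integrable_abse (hi K))).
      exact: measurableT_comp.
  + exact: cvg_cst.
  + apply: fine_cvg; move: H_cvg => /=.
    by under eq_fun do under eq_integral do rewrite sube0.
- apply: filterS (integrable_ae measurableT (Hi K)) => x /(_ I) Hfin.
  by rewrite -lee_fin /h fineK//; exact: uH.
Qed.
End ergodic.

(** * Averages *)

Section average.
Context d (X : measurableType d) (R : realType).
Variable mu : {finite_measure set X -> \bar R}.

(** A real-valued version of [average], for the arithmetic of averages. When
    [mu A = 0] both are 0, although for different reasons: the inverse of 0 is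
    0 in R and infinite in the extended reals, where infinity times 0 is 0. *)
Definition raverage (f : X -> R) (A : set X) : R :=
  (fine (mu A))^-1 * \int[mu]_(x in A) f x.

Lemma averageE (f : X -> R) (A : set X) : measurable A ->
  mu.-integrable [set: X] (EFin \o f) ->
  average mu f A = (raverage f A)%:E.
Proof.
move=> mA fi; have fiA : mu.-integrable A (EFin \o f) by exact: integrableS fi.
rewrite /average /raverage -[X in (_ * X)%E]fineK ?integrable_fin_num//.
have [muA0|muA0] := eqVneq (mu A) 0%E.
  rewrite muA0 invr0 mul0r null_set_integral// ?mule0//.
  exact: measurable_int fiA.
rewrite -[X in (X^-1 * _)%E]fineK ?fin_num_measure// inver ifF ?EFinM//.
apply: contraNF muA0 => /eqP muA0.
by rewrite -[mu A]fineK ?fin_num_measure// muA0.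
Qed.

Lemma raverageD (f g : X -> R) (A : set X) : measurable A ->
  mu.-integrable [set: X] (EFin \o f) -> mu.-integrable [set: X] (EFin \o g) ->
  raverage (fun x => f x + g x) A = raverage f A + raverage g A.
Proof.
move=> mA fi gi; rewrite /raverage RintegralD ?mulrDr//.
- exact: integrableS fi.
- exact: integrableS gi.
Qed.

Lemma raverageB (f g : X -> R) (A : set X) : measurable A ->
  mu.-integrable [set: X] (EFin \o f) -> mu.-integrable [set: X] (EFin \o g) ->
  raverage (fun x => f x - g x) A = raverage f A - raverage g A.
Proof.
move=> mA fi gi; rewrite /raverage RintegralB ?mulrBr//.
- exact: integrableS fi.
- exact: integrableS gi.
Qed.

Lemma raverageZ (c : R) (f : X -> R) (A : set X) : measurable A ->
  mu.-integrable [set: X] (EFin \o f) ->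
  raverage (fun x => c * f x) A = c * raverage f A.
Proof.
move=> mA fi; rewrite /raverage RintegralZl//; first by rewrite mulrCA.
exact: integrableS fi.
Qed.

Lemma raverage_cst (c : R) (A : set X) : measurable A -> (0 < mu A)%E ->
  raverage (cst c) A = c.
Proof.
move=> mA A0; rewrite /raverage Rintegral_cst// mulrC mulfK//.
by rewrite gt_eqF// fine_gt0// A0/= ltey_eq fin_num_measure.
Qed.

Lemma le_normr_raverage (f : X -> R) (A : set X) : measurable A ->
  mu.-integrable [set: X] (EFin \o f) ->
  `|raverage f A| <= raverage (fun x => `|f x|) A.
Proof.
move=> mA fi; rewrite /raverage normrM ger0_norm ?invr_ge0 ?fine_ge0//.
rewrite ler_wpM2l ?invr_ge0 ?fine_ge0// le_normr_Rintegral//.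
exact: integrableS fi.
Qed.

Lemma ae_le_raverage (f g : X -> R) (A : set X) : measurable A ->
  mu.-integrable [set: X] (EFin \o f) -> mu.-integrable [set: X] (EFin \o g) ->
  {ae mu, forall x, `|f x| <= g x} ->
  `|raverage f A| <= raverage (fun x => `|g x|) A.
Proof.
move=> mA fi gi fg; apply: le_trans (le_normr_raverage mA fi) _.
rewrite /raverage ler_wpM2l ?invr_ge0 ?fine_ge0//.
have nfi : mu.-integrable A (EFin \o (Num.norm \o f)).
  by apply: integrableS (integrable_norm fi).
have ngi : mu.-integrable A (EFin \o (Num.norm \o g)).
  by apply: integrableS (integrable_norm gi).
apply: fine_le; [exact: integrable_fin_num|exact: integrable_fin_num|].
apply: ae_ge0_le_integral => //.
- exact: measurable_int nfi.
- exact: measurable_int ngi.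
- by apply: filterS fg => x fgx _; rewrite lee_fin (le_trans fgx)// ler_norm.
Qed.

End average.

(** * Measurability of the maximal function *)

Section borel.
Context {R : realType} {X : pointedMetricType R}.

Lemma open_from_balls (U : set X) :
  (forall x, U x -> exists2 e : R, 0 < e & ball x e `<=` U) -> open U.
Proof.
by move=> UB; rewrite openE => x /UB[e e0 ?]; apply/nbhs_ballP; exists e.
Qed.

Lemma open_metric_ball (x : X) (r : R) : open (ball x r).
Proof.
apply: open_from_balls => y xy; exists (r - mdist x y).
  by move: xy; rewrite ballEmdist/= subr_gt0.
move=> z; move: xy; rewrite !ballEmdist/= => xy yz.
by apply: le_lt_trans (metric_triangle x y z) _; rewrite -ltrBrDl.
Qed.

Lemma measurable_open (U : set X) : open U -> measurable (U : set (borel X)).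
Proof. exact: sub_sigma_algebra. Qed.

Lemma measurable_metric_ball (x : X) (r : R) :
  measurable (ball x r : set (borel X)).
Proof. by apply: measurable_open; exact: open_metric_ball. Qed.

End borel.

#[local] Hint Extern 0 (measurable (ball _ _)) =>
  solve [apply: measurable_metric_ball] : core.

Section hardy_littlewood.
Context {R : realType} {X : pointedMetricType R}.
Variable mu : probability (borel X) R.
Implicit Types f : borel X -> R.

(** An open ball is the increasing union of the concentric open balls of smaller
    radii. *)
Lemma ball_integral_left_continuous f (x : borel X) (r c : R) :
  mu.-integrable [set: borel X] (EFin \o f) -> (forall y, 0 <= f y) -> 0 < r ->
  c < \int[mu]_(y in ball x r) f y ->
  exists2 s, 0 <= s < r & c < \int[mu]_(y in ball x s) f y.
Proof.
move=> fi f0 r0 cr; apply: contrapT => small.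
(* Radii r (1 - 1/(n+1)) increase to r and never become negative. *)
pose s n := r - r / n.+1%:R.
have sr n : 0 <= s n < r.
  rewrite subr_ge0 gtrBl divr_gt0// andbT ler_piMr ?invf_le1 ?ler1n//.
  exact: ltW.
have le_c n : \int[mu]_(y in ball x (s n)) f y <= c.
  by rewrite leNgt; apply/negP => cs; apply: small; exists (s n).
have iB t : mu.-integrable (ball x t) (EFin \o f) by exact: integrableS fi.
have ballU : \bigcup_n ball x (s n) = ball x r.
  apply/seteqP; split => [y [n _]|y].
    by apply: le_ball; rewrite ltW//; case/andP: (sr n).
  rewrite ballEmdist/= -subr_gt0 => e0.
  exists (Num.bound (r / (r - mdist x y))) => //; rewrite ballEmdist/=.
  rewrite ltrBrDr -ltrBrDl ltr_pdivrMr// mulrC -ltr_pdivrMr//.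
  apply: lt_le_trans (archi_boundP _) _; last by rewrite ler_nat.
  by rewrite divr_ge0// ltW.
have ndB : nondecreasing_seq (fun n => ball x (s n) : set (borel X)).
  move=> n m nm; apply/subsetPset/le_ball; rewrite lerD2l lerN2 ler_pM2l//.
  by rewrite lef_pV2 ?posrE// ler_nat.
have := @ge0_nondecreasing_set_cvg_integral _ _ _ _ (EFin \o f) mu ndB
  (fun n => measurable_metric_ball _ _) (fun n => measurable_int _ (iB _))
  (fun _ y _ => f0 y).
rewrite ballU => cvg_int.
move: cr; apply/negP; rewrite -leNgt -lee_fin fineK ?integrable_fin_num//.
rewrite -(cvg_lim _ cvg_int)//; apply: lime_le.
  by apply/cvg_ex; eexists; exact: cvg_int.
apply: nearW => n.
by have := le_c n; rewrite -lee_fin fineK ?integrable_fin_num.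
Qed.

(** In this form there is no quotient, and a ball of measure 0 cannot occur on
    the right, as both sides of the inequality would vanish. *)
Lemma maximal_gtP f (x : borel X) (e : R) :
  mu.-integrable [set: borel X] (EFin \o f) -> 0 <= e ->
  (e%:E < maximal mu f x)%E <->
  exists2 r, 0 < r &
    e * fine (mu (ball x r)) < \int[mu]_(y in ball x r) `|f y|.
Proof.
move=> fi e0; have nfi := integrable_norm fi.
have iB t : mu.-integrable (ball x t) (EFin \o (Num.norm \o f)).
  exact: integrableS nfi.
have avgE r : average mu (fun y => `|f y|) (ball x r) =
    ((fine (mu (ball x r)))^-1 * \int[mu]_(y in ball x r) `|f y|)%:E.
  by rewrite averageE.
have lt_avg r :
    (e < (fine (mu (ball x r)))^-1 * \int[mu]_(y in ball x r) `|f y|) =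
    (e * fine (mu (ball x r)) < \int[mu]_(y in ball x r) `|f y|).
  have : 0 <= fine (mu (ball x r)) by exact: fine_ge0.
  rewrite le_eqVlt => /orP[/eqP m0|m0]; last by rewrite ltr_pdivlMl// mulrC.
  rewrite -m0 invr0 mul0r mulr0 ltNge e0/=; apply/esym/negbTE; rewrite -leNgt.
  rewrite /Rintegral null_set_integral//; first exact: measurable_int (iB r).
  by rewrite -[LHS]fineK ?fin_num_measure//; congr EFin; exact: esym.
split.
  case/ereal_sup_gt => _ [r /= r0 <-]; rewrite avgE lte_fin lt_avg => er.
  by exists r.
case=> r r0; rewrite -lt_avg -lte_fin -avgE => /lt_le_trans; apply.
by apply: ereal_sup_ubound; exists r.
Qed.

(** If the average of [|f|] over B(x, r) exceeds e, the integral over a slightly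
    smaller ball B(x, s) still exceeds [e * mu (B(x, r))]. For y close to x, the
    ball of radius [(r + s) / 2] around y lies between these two, so its
    average exceeds e as well. *)
Lemma open_maximal_gt f (e : R) : mu.-integrable [set: borel X] (EFin \o f) ->
  0 <= e -> open ([set x | (e%:E < maximal mu f x)%E] : set X).
Proof.
move=> fi e0; have nfi := integrable_norm fi.
have iB t (x : borel X) : mu.-integrable (ball x t) (EFin \o (Num.norm \o f)).
  exact: integrableS nfi.
apply: open_from_balls => x /= /(maximal_gtP x fi e0)[r r0 er].
have [s /andP[s0 sr] es] :=
  ball_integral_left_continuous nfi (fun=> normr_ge0 _) r0 er.
exists ((r - s) / 2); first by rewrite divr_gt0// subr_gt0.
move=> y xy; apply/(maximal_gtP y fi e0); exists ((r + s) / 2).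
  by rewrite divr_gt0// ltr_wpDr.
have sB : ball x s `<=` ball y ((r + s) / 2).
  move=> z xz; have -> : (r + s) / 2 = (r - s) / 2 + s by lra.
  exact: ball_triangle (ball_sym xy) xz.
have Br : ball y ((r + s) / 2) `<=` ball x r.
  move=> z yz; have -> : r = (r - s) / 2 + (r + s) / 2 by lra.
  exact: ball_triangle xy yz.
apply: (@le_lt_trans _ _ (e * fine (mu (ball x r)))).
  rewrite ler_wpM2l// fine_le ?fin_num_measure//.
  by apply: le_measure; rewrite ?inE.
apply: (lt_le_trans es); rewrite /Rintegral fine_le ?integrable_fin_num//.
apply: ge0_subset_integral => //; first exact: measurable_int (iB _ _).
by move=> z _; rewrite lee_fin/=.
Qed.

Lemma maximal_ge0 f x : (0 <= maximal mu f x)%E.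
Proof.
apply: ereal_sup_ge; exists (average mu (fun y => `|f y|) (ball x 1)).
  by exists 1 => /=.
by rewrite mule_ge0 ?inve_ge0// integral_ge0// => y _; rewrite lee_fin.
Qed.

(** The weak type inequality bounds the measure of superlevel sets of the
    maximal function; a measure is only monotone on measurable sets, so their
    measurability has to be known before that bound can be used. *)
Lemma measurable_maximal f : mu.-integrable [set: borel X] (EFin \o f) ->
  measurable_fun [set: borel X] (maximal mu f).
Proof.
move=> fi; apply: (measurability _ (ErealGenOInfty.measurableE R)).
move=> _ [_ [e ->] <-]; rewrite setTI.
rewrite (_ : _ @^-1` _ = [set x | (e%:E < maximal mu f x)%E]); last first.
  by apply/seteqP; split => x /=; rewrite in_itv/= andbT.
have [e0|e0] := leP 0 e.
  by apply: measurable_open; exact: open_maximal_gt.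
rewrite (_ : [set x | _] = setT)//; apply/seteqP; split => // x _ /=.
by apply: lt_le_trans (maximal_ge0 f x); rewrite lte_fin.
Qed.
End hardy_littlewood.

(** * Lebesgue differentiation *)

(** The integral is the measure of the part of the union not yet covered, which
    decreases to 0. *)
Lemma cvg_Rintegral_indicB d (X : measurableType d) (R : realType)
    (mu : {finite_measure set X -> \bar R}) (A : (set X)^nat) :
  (forall n, measurable (A n)) -> nondecreasing_seq A ->
  \int[mu]_x `|\1_(\bigcup_k A k) x - \1_(A n) x : R| @[n --> \oo] --> (0 : R).
Proof.
move=> mA ndA; set U := \bigcup_k A k.
have mU : measurable U by exact: bigcupT_measurable.
have mD n : measurable (U `\` A n) by exact: measurableD.
have intE n : \int[mu]_x `|\1_U x - \1_(A n) x : R| = fine (mu (U `\` A n)).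
  rewrite -[U `\` _]setIT -integral_indic// /Rintegral; congr fine.
  apply: eq_integral => x _; congr EFin; rewrite !indicE in_setD.
  have [xA|xA] := boolP (x \in A n); last by rewrite subr0 andbT ger0_norm.
  rewrite andbF (_ : x \in U); first by rewrite subrr normr0.
  by rewrite inE; exists n => //; rewrite inE in xA.
under eq_fun do rewrite intE.
apply: fine_cvg; rewrite (_ : 0%:E = mu (\bigcap_n (U `\` A n))); last first.
  rewrite (_ : \bigcap_n _ = set0) ?measure0//.
  apply/seteqP; split => // x Ux; have [[n _ Anx] _] := Ux 0%N I.
  by have [] := Ux n I.
apply: nonincreasing_cvg_mu => //.
- by rewrite ltey_eq fin_num_measure.
- exact: bigcapT_measurable.
- move=> n m nm; apply/subsetPset; apply: setDS; apply/subsetPset.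
  exact: ndA.
Qed.

Section hardy_littlewood.
Context {R : realType} {X : pointedMetricType R}.
Variable mu : probability (borel X) R.
Hypothesis mu_ball :
  {ae mu, forall x, forall r : R, 0 < r -> (0 < mu (ball x r))%E}.
Hypothesis maximal_weak : weak_type11_maximal mu.
Implicit Types f : borel X -> R.

(** For fixed e, the set where the maximal function of h_n or h_n itself is at
    least e has measure at most [(C + 1) / e] times the L^1 norm of h_n, by the
    weak type and Markov inequalities. The points that belong to all of these
    sets therefore form a null set. *)
Lemma maximal_small (h : nat -> borel X -> R) :
  (forall n, mu.-integrable [set: borel X] (EFin \o h n)) ->
  \int[mu]_x `|h n x| @[n --> \oo] --> 0 ->
  {ae mu, forall x, forall e : R, 0 < e ->
    exists n, (maximal mu (h n) x < e%:E)%E /\ `|h n x| < e}.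
Proof.
move=> hi h0; have [C C1 weak] := maximal_weak.
pose B (e : R) n := [set x | (e%:E <= maximal mu (h n) x)%E] `|`
                    [set x | (e%:E <= `|(h n x)%:E|)%E].
have mh n : measurable_fun [set: borel X] (EFin \o h n).
  exact: measurable_int (hi n).
have mB1 e n : measurable [set x | (e%:E <= maximal mu (h n) x)%E].
  rewrite -[X in measurable X]setTI; apply: emeasurable_fun_c_infty => //.
  exact: measurable_maximal.
have mB2 e n : measurable [set x | (e%:E <= `|(h n x)%:E|)%E].
  rewrite -[X in measurable X]setTI; apply: emeasurable_fun_c_infty => //.
  apply: measurableT_comp => //; exact: mh.
have mB e n : measurable (B e n) by exact: measurableU.
have intE n : (\int[mu]_x `|(h n x)%:E| = (\int[mu]_x `|h n x|)%:E)%E.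
  by rewrite fineK// integrable_fin_num//; exact: (integrable_norm (hi n)).
have muB e n : 0 < e ->
    (mu (B e n) <= ((C + 1) / e * \int[mu]_x `|h n x|)%:E)%E.
  move=> e0; apply: le_trans (measureU2 _ (mB1 e n) (mB2 e n)) _.
  rewrite !mulrDl EFinD leeD//.
    have hL1 : h n \in Lfun mu 1%E by apply/Lfun1_integrable; exact: hi.
    by have := weak _ _ hL1 e0; rewrite Lnorm1 intE.
  rewrite mul1r EFinM lee_pdivlMl// -intE.
  have := @le_integral_comp_abse _ _ _ mu _ measurableT (EFin \o h n) e id.
  by rewrite setTI; apply => // x y.
have mu0 e : 0 < e -> mu (\bigcap_n B e n) = 0%E.
  move=> e0; have mcap : measurable (\bigcap_n B e n).
    exact: bigcapT_measurable.
  apply/eqP; rewrite eq_le measure_ge0 andbT -[leLHS]fineK ?fin_num_measure//.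
  rewrite lee_fin.
  have cvg0 : (C + 1) / e * \int[mu]_x `|h n x| @[n --> \oo] --> 0.
    by rewrite -[X in _ --> X](mulr0 ((C + 1) / e)); exact: cvgMr.
  rewrite -(cvg_lim _ cvg0)//; apply: limr_ge; first by apply/cvg_ex; exists 0.
  apply: nearW => n; rewrite -lee_fin fineK ?fin_num_measure//.
  apply: le_trans (muB e n e0); apply: le_measure; rewrite ?inE//.
  exact: bigcap_inf.
have invn0 n : 0 < n.+1%:R^-1 :> R by rewrite invr_gt0.
have good n : {ae mu, forall x, exists k,
    (maximal mu (h k) x < (n.+1%:R^-1)%:E)%E /\ `|h k x| < n.+1%:R^-1}.
  exists (\bigcap_k B n.+1%:R^-1 k).
  split; [exact: bigcapT_measurable|exact: mu0|].
  move=> x /= bad k _; apply: contrapT => /not_orP[/negP + /negP].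
  by rewrite -!ltNge => ? ?; apply: bad; exists k.
apply: filterS (ae_foralln good) => x gx e e0.
have [n n_e] := exists_invS_le e0.
have [k [Mk hk]] := gx n; exists k; split; last exact: lt_le_trans n_e.
by apply: lt_le_trans Mk _; rewrite lee_fin.
Qed.

Lemma averages_small (h : nat -> borel X -> R) :
  (forall n, mu.-integrable [set: borel X] (EFin \o h n)) ->
  \int[mu]_x `|h n x| @[n --> \oo] --> 0 ->
  {ae mu, forall x, forall e : R, 0 < e ->
    exists n, `|h n x| < e /\
      forall r, 0 < r -> raverage mu (fun y => `|h n y|) (ball x r) < e}.
Proof.
move=> hi h0; apply: filterS (maximal_small hi h0) => x small e e0.
have [n [Mn hn]] := small e e0; exists n; split => // r r0.
rewrite -lte_fin -averageE//; last exact: integrable_norm (hi n).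
by apply: le_lt_trans Mn; apply: ereal_sup_ubound; exists r.
Qed.

Definition lebesgue_differentiable f :=
  {ae mu, forall x, raverage mu f (ball x r) @[r --> 0^'+] --> f x}.

Lemma lebesgue_differentiable_cst (c : R) : lebesgue_differentiable (cst c).
Proof.
apply: filterS mu_ball => x Bx; apply: cvg_near_cst; near=> r.
by rewrite raverage_cst//; apply: Bx.
Unshelve. all: by end_near. Qed.

Lemma lebesgue_differentiableZD (c : R) f g :
  mu.-integrable [set: borel X] (EFin \o f) ->
  mu.-integrable [set: borel X] (EFin \o g) ->
  lebesgue_differentiable f -> lebesgue_differentiable g ->
  lebesgue_differentiable (fun x => c * f x + g x).
Proof.
move=> fi gi; apply: filterS2 => x fx gx.
under eq_fun.
  move=> r; rewrite raverageD// ?raverageZ//; last first.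
    exact: (integrableZl measurableT c fi).
  over.
by apply: cvgD => //; exact: cvgMr.
Qed.

(** The error [f - phi n] has, at almost every x and for some n, small averages
    over all balls around x and a small value at x; for that n, the averages of
    phi n converge. *)
Lemma lebesgue_differentiable_lim (phi : nat -> borel X -> R) f :
  mu.-integrable [set: borel X] (EFin \o f) ->
  (forall n, mu.-integrable [set: borel X] (EFin \o phi n)) ->
  (forall n, lebesgue_differentiable (phi n)) ->
  \int[mu]_x `|f x - phi n x| @[n --> \oo] --> 0 ->
  lebesgue_differentiable f.
Proof.
move=> fi phii phiL phi_f; pose h n x := f x - phi n x.
have hi n : mu.-integrable [set: borel X] (EFin \o h n).
  exact: (integrableB measurableT fi (phii n)).
have := averages_small hi phi_f.
apply: filterS2 (ae_foralln phiL) => x phix small.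
apply/cvgrPdist_lt => e e0; have e30 : 0 < e / 3 by rewrite divr_gt0.
have [n [hn avgn]] := small _ e30.
have /cvgrPdist_lt/(_ _ e30) := phix n.
apply: filterS2 (nbhs_right_gt 0) => r r0 phi_r.
have := avgn r r0; move=> /(le_lt_trans (le_normr_raverage _ (hi n))).
rewrite raverageB// => /(_ (measurable_metric_ball _ _)) avg_h.
rewrite (_ : f x - _ = h n x + (phi n x - raverage mu (phi n) (ball x r)) -
  (raverage mu f (ball x r) - raverage mu (phi n) (ball x r))); last first.
  by rewrite /h; ring.
apply: le_lt_trans (ler_normB _ _) _.
apply: le_lt_trans (lerD (ler_normD _ _) (lexx _)) _.
lra.
Qed.

(** At points of U the averages are eventually 1. For x outside U, let A_n be
    the set of points whose ball of radius 1/(n+1) lies in U. No point of A_n is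
    within 1/(n+1) of x, so for small r the averages of the indicator of U over
    B(x, r) are those of the indicator of [U \ A_n], which are small for a
    suitable n because A_n increases to U. *)
Lemma lebesgue_differentiable_indic_open (U : set X) : open U ->
  lebesgue_differentiable (\1_U : borel X -> R).
Proof.
move=> oU; pose A n : set (borel X) := [set x | ball x (n.+1%:R^-1) `<=` U].
have invn0 n : 0 < n.+1%:R^-1 :> R by rewrite invr_gt0.
have mA n : measurable (A n).
  rewrite -[A n]setCK; apply: measurableC; apply: measurable_open.
  apply: open_from_balls => y /= /existsNP[z /not_implyP[yz zU]].
  exists (n.+1%:R^-1 - mdist y z).
    by move: yz; rewrite ballEmdist/= subr_gt0.
  move=> x; rewrite ballEmdist/= => yx BxU; apply: zU; apply: BxU.
  rewrite ballEmdist/=; apply: le_lt_trans (metric_triangle x y z) _.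
  by rewrite (metric_sym x) -ltrBrDr.
have ndA : nondecreasing_seq A.
  move=> n m nm; apply/subsetPset => x; apply: subset_trans; apply: le_ball.
  by rewrite lef_pV2 ?posrE// ler_nat.
have AU : \bigcup_n A n = U.
  apply/seteqP; split => [x [n _ Anx]|x Ux]; first exact/Anx/ballxx.
  have : nbhs (x : X) U by exact: open_nbhs_nbhs.
  move=> /nbhs_ballP[e /= /exists_invS_le[n n_e] xeU]; exists n => //.
  exact: subset_trans (le_ball n_e) xeU.
pose h n : borel X -> R := fun x => \1_U x - \1_(A n) x.
have mU : measurable (U : set (borel X)) by exact: measurable_open.
have indi (B : set (borel X)) : measurable B ->
    mu.-integrable [set: borel X] (EFin \o (\1_B : borel X -> R)).
  exact: integrable_indic.
have hi n : mu.-integrable [set: borel X] (EFin \o h n).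
  exact: (integrableB measurableT (indi _ mU) (indi _ (mA n))).
have := cvg_Rintegral_indicB mu mA ndA; rewrite AU => /(averages_small hi).
apply: filterS2 mu_ball => x Bx small.
have [Ux|Ux] := pselect (U x).
  have : nbhs (x : X) U by exact: open_nbhs_nbhs.
  move=> /nbhs_ballP[e /= e0 xeU]; apply: cvg_near_cst; near=> r.
  rewrite -[RHS](raverage_cst (mu := mu) _ (measurable_metric_ball x r));
    last by apply: Bx.
  congr (_ * _); apply: eq_Rintegral => y /set_mem xy.
  rewrite /= !indicE !mem_set//; apply: xeU; apply: le_ball xy.
  by near: r; exact: nbhs_right_le.
rewrite indicE memNset//; apply/cvgrPdist_lt => e /small[n [_ avg_n]].
near=> r; rewrite sub0r normrN.
rewrite (_ : raverage _ _ _ = raverage mu (h n) (ball x r)).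
  apply: le_lt_trans (le_normr_raverage _ (hi n)) _ => //.
  exact: avg_n.
congr (_ * _); apply: eq_Rintegral => y /set_mem xy.
rewrite /h [\1_(A n) y]indicE memNset ?subr0// => Any; apply: Ux; apply: Any.
apply: ball_sym; apply: le_ball xy.
by near: r; exact: nbhs_right_le.
Unshelve. all: by end_near. Qed.

(** The Borel sets with this property form a lambda-system, and the open sets
    are a pi-system that generates the Borel sets. *)
Lemma lebesgue_differentiable_indic (A : set (borel X)) : measurable A ->
  lebesgue_differentiable (\1_A : borel X -> R).
Proof.
have indi (B : set (borel X)) : measurable B ->
    mu.-integrable [set: borel X] (EFin \o (\1_B : borel X -> R)).
  exact: integrable_indic.
pose H : set (set (borel X)) :=
  [set B | measurable B /\ lebesgue_differentiable (\1_B : borel X -> R)].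
suff sub : <<s @open X >> `<=` H by move=> /sub[].
apply: (@lambda_system_subset _ (@open X) _ setT H).
- exact: openI.
- split => //.
  + split => //; have -> : \1_[set: borel X] = cst 1 :> (_ -> R).
      by apply/funext => x; rewrite indicT.
    exact: lebesgue_differentiable_cst.
  + move=> B A' A'B [mB LB] [mA' LA']; split; first exact: measurableD.
    rewrite (_ : \1_(B `\` A') = (fun x => -1 * \1_A' x + \1_B x) :> (_ -> R)).
      by apply: lebesgue_differentiableZD => //; exact: indi.
    apply/funext => x; rewrite !indicE in_setD mulN1r addrC.
    have [xA|xA] := boolP (x \in A'); last by rewrite andbT subr0.
    by rewrite andbF (_ : x \in B) ?subrr// inE; apply: A'B; rewrite inE in xA.
  + move=> F ndF HF.
    have mF n : measurable (F n : set (borel X)) by case: (HF n).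
    have mU : measurable (\bigcup_n F n : set (borel X)).
      exact: bigcupT_measurable.
    split => //; apply: (lebesgue_differentiable_lim (indi _ mU)).
    * by move=> n; apply: indi; exact: mF.
    * by move=> n; case: (HF n).
    * exact: cvg_Rintegral_indicB.
- move=> U oU; split; first exact: measurable_open.
  exact: lebesgue_differentiable_indic_open.
- by [].
Qed.

Lemma lebesgue_differentiable_sum (I : eqType) (s : seq I) (c : I -> R)
    (A : I -> set (borel X)) : (forall i, measurable (A i)) ->
  mu.-integrable [set: borel X]
    (EFin \o (fun x => \sum_(i <- s) c i * \1_(A i) x)) /\
  lebesgue_differentiable (fun x => \sum_(i <- s) c i * \1_(A i) x).
Proof.
move=> mA; elim: s => [|i s [si sL]].
  under eq_fun do rewrite big_nil.
  by split; [exact: (integrable0 mu)|exact: lebesgue_differentiable_cst].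
under eq_fun do rewrite big_cons.
have Ai : mu.-integrable [set: borel X] (EFin \o (\1_(A i) : borel X -> R)).
  exact: integrable_indic.
split.
  exact: (integrableD measurableT (integrableZl measurableT (c i) Ai) si).
by apply: lebesgue_differentiableZD => //; exact: lebesgue_differentiable_indic.
Qed.

Import HBSimple.

(** Simple functions are dense in L^1. *)
Lemma lebesgue_differentiation_metric f :
  mu.-integrable [set: borel X] (EFin \o f) -> lebesgue_differentiable f.
Proof.
move=> fi; have [g [gi _ gf]] := approximation_sfun_integrable measurableT fi.
apply: (lebesgue_differentiable_lim fi gi).
- move=> n.
  have -> : (g n : borel X -> R) =
      (fun x => \sum_(y <- finmap.enum_fset (fset_set (range (g n))))
        y * \1_(g n @^-1` [set y]) x).
    by apply/funext => x; rewrite fimfunE fsbig_finite.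
  apply: (lebesgue_differentiable_sum _ id _).2 => y.
  exact: measurable_funPTI.
- exact: (fine_cvg gf).
Qed.
End hardy_littlewood.

(** * Joint convergence *)

Theorem theorem2 (R : realType) (X : pointedMetricType R)
    (mu : probability (borel X) R) (T : borel X -> borel X)
    (T_preserving : measure_preserving mu T)
    (mu_ball : {ae mu, forall x, forall r : R, 0 < r -> (0 < mu (ball x r))%E})
    (maximal_weak : weak_type11_maximal mu)
    (p : R) (p_gt1 : 1 < p) (f : borel X -> R) (f_Lp : f \in Lfun mu p%:E) :
  {ae mu, forall x,
    average mu (birkhoff_average T f rk.2) (ball x rk.1)
      @[rk --> filter_prod (0 : R)^'+ \oo]
    --> (cond_expectation mu (invariant_sets T) f x)%:E}.
Proof.
have fi : mu.-integrable [set: borel X] (EFin \o f).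
  apply/Lfun1_integrable; apply: Lfun_subset f_Lp;
    by rewrite ?fin_num_measure// ?lee_fin ltW.
have gE := cond_expectation_invariantP T fi.
move: (cond_expectation _ _ _) gE => g gE; have [_ gi _] := gE.
have [h [hi h0 hdom]] := birkhoff_tail_envelope T_preserving p_gt1 f_Lp gE.
have := averages_small maximal_weak hi h0.
have := lebesgue_differentiation_metric mu_ball maximal_weak gi.
apply: filterS2 => x gx hx.
have avgi k := integrable_birkhoff_average T_preserving k fi.
under eq_fun do rewrite averageE//.
apply: cvg_EFin; first exact: nearW.
apply/cvgrPdist_lt => e e0; have e20 : 0 < e / 2 by rewrite divr_gt0.
have [K [_ hK]] := hx _ e20.
have /cvgrPdist_lt/(_ _ e20) g_near := gx.
exists ([set r | 0 < r /\ `|g x - raverage mu g (ball x r)| < e / 2],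
        [set k | (K <= k)%N]).
  split => /=; last by exists K.
  by apply: filterI; [exact: nbhs_right_gt|exact: g_near].
move=> [r k] /= [[r0 gr] Kk].
have := ae_le_raverage (measurable_metric_ball x r)
  (integrableB measurableT (avgi k) gi) (hi K) (hdom K k Kk).
rewrite raverageB// => /le_lt_trans/(_ (hK r r0)) hr.
rewrite (_ : _ - _ = g x - raverage mu g (ball x r) -
  (raverage mu (birkhoff_average T f k) (ball x r) - raverage mu g (ball x r))).
  by apply: le_lt_trans (ler_normB _ _) _; rewrite [e]splitr ltrD.
by rewrite opprB addrA subrK.
Qed.
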